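(* If a graph $G$ is $12$-representable by a $123$-avoiding word, then $G$ is the complement of a max point-tolerance (MPT) graph.
   Context: All graphs are finite, simple and undirected. Let $[n]=\{1,\ldots,n\}$. For a word $w$ over positive integers, $\mathrm{red}(w)$ is the word obtained from $w$ by replacing each occurrence of the $i$th smallest letter with $i$. For a word (pattern) $p=p_1\cdots p_k$ with $\mathrm{red}(p)=p$, a word $w=w_1\cdots w_\ell$ contains $p$ if there are indices $i_1<\cdots<i_k$ with $\mathrm{red}(w_{i_1}\cdots w_{i_k})=p$; otherwise $w$ avoids $p$ (is $p$-avoiding). A labeled graph with vertex set $[n]$ is $12$-represented by a word $w$ over $[n]$ containing at least one copy of each letter of $[n]$ if for all $i<j$ in $[n]$: $i$ and $j$ are adjacent if and only if every occurrence of $j$ precedes every occurrence of $i$ in $w$. An (unlabeled) graph on $n$ vertices is $12$-representable by a $p$-avoiding word if its vertices can be labeled bijectively by $[n]$ so that the resulting labeled graph is $12$-represented by some $p$-avoiding word. A graph $H$ is a max point-tolerance (MPT) graph if each vertex $v$ can be assigned an interval $I_v$ on the real line together with a point $p_v\in I_v$ such that for any two distinct vertices $u,v$: $uv\in E(H)$ if and only if $\{p_u,p_v\}\subseteq I_u\cap I_v$. *)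

(* Defs.v *)
From mathcomp Require Import all_boot all_order all_algebra.
From mathcomp Require Import classical_sets reals.

Set Implicit Arguments.
Unset Strict Implicit.
Unset Printing Implicit Defensive.

(* A graph on the finite vertex type V is given by its adjacency relation. *)
Definition simple_graph (V : finType) (e : rel V) : Prop :=
  symmetric e /\ irreflexive e.

Definition complement (V : finType) (e : rel V) : rel V :=
  [rel u v | (u != v) && ~~ e u v].

Definition red (w : seq nat) : seq nat :=
  [seq (index x (sort leq (undup w))).+1 | x <- w].

Definition contains (p w : seq nat) : Prop :=
  exists2 s, subseq s w & red s = p.

Definition avoids (p w : seq nat) : Prop := ~ contains p w.

(* All occurrences of the letter x in w precede all occurrences of y. *)
Definition all_precede (w : seq nat) (x y : nat) : Prop :=
  forall a b, a < size w -> b < size w ->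
    nth 0 w a = x -> nth 0 w b = y -> a < b.

(* Labels and letters are 1, ..., n: the ordinal i : 'I_n stands for the label
   i.+1.  The first clause says both that w is a word over [n] and that every
   letter of [n] occurs in w. *)
Definition represents12 (n : nat) (e : rel 'I_n) (w : seq nat) : Prop :=
  (forall x, (x \in w) = (1 <= x <= n)) /\
  (forall i j : 'I_n, i < j -> (e i j <-> all_precede w j.+1 i.+1)).

(* The labeling is given by l, sending a label to the vertex that carries it. *)
Definition representable12_avoiding
    (p : seq nat) (V : finType) (e : rel V) : Prop :=
  exists l : 'I_#|V| -> V, bijective l /\
    exists w : seq nat, represents12 (relpre l e) w /\ avoids p w.

(* Intervals may be open, closed, half-open or unbounded. *)
Definition max_point_tolerance
    (R : realType) (V : finType) (e : rel V) : Prop :=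
  exists (I : V -> interval R) (p : V -> R),
    (forall v, p v \in I v) /\
    (forall u v, u != v ->
      (e u v <-> ([set p u; p v] `<=` [set` I u] `&` [set` I v])%classic)).

(* Main.v *)
Require Import Defs.
From mathcomp Require Import all_boot all_order all_algebra.
From mathcomp Require Import classical_sets reals.
From mathcomp Require Import boolp.

(** Let [H] be the complement of [G]. For labels [i < j], the vertices [i] and
    [j] are adjacent in [H] exactly when some [i] occurs before some [j] in the
    word [w]. The label order on [H] then has the following property: if
    [a < b < c < d] and both [ac] and [bd] are edges of [H], so is [bc]. Indeed,
    if [bc] is not an edge, all [c]'s precede all [b]'s, so that [w] contains
    [a ... c ... b ... d], whose letters [a], [c], [d] form a copy of 123
    ([nonadjacency_four_point]).

    Such an ordering makes any graph an MPT graph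
    ([max_point_tolerance_of_four_point]): take the rank of [v] as its point,
    and the span of its closed neighbourhood as its interval. If [b < c] lie in
    each other's intervals, then [c] is at most the last neighbour [d] of [b]
    and [b] is at least the first neighbour [a] of [c]; either one of these is
    an equality, or the four-point property applied to [a < b < c < d] shows
    that [bc] is an edge. *)

Set Implicit Arguments.
Unset Strict Implicit.
Unset Printing Implicit Defensive.

Import Num.Theory.

Lemma red_increasing (s : seq nat) : sorted ltn s -> red s = iota 1 (size s).
Proof.
move=> ss.
have us : uniq s by apply: sorted_uniq ss; [exact: ltn_trans | exact: ltnn].
have -> : red s = [seq (index x s).+1 | x <- s].
  rewrite /red undup_id // sorted_sort //; first exact: leq_trans.
  by apply: sub_sorted ss => x y /ltnW.
apply: (@eq_from_nth _ 0) => [|i]; first by rewrite size_map size_iota.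
rewrite size_map => lti.
by rewrite (nth_map 0) // index_uniq // nth_iota.
Qed.

Lemma subseq_of_positions (w ps : seq nat) :
  sorted ltn ps -> all (gtn (size w)) ps -> subseq [seq nth 0 w i | i <- ps] w.
Proof.
move=> sps /allP ltps; rewrite -{2}(mkseq_nth 0 w); apply: map_subseq.
(* An increasing list of positions is a filtered [iota]. *)
suff -> : ps = [seq i <- iota 0 (size w) | i \in ps] by exact: filter_subseq.
apply: (irr_sorted_eq ltn_trans ltnn) => // [|i].
  by apply: sorted_filter; [exact: ltn_trans | exact: iota_ltn_sorted].
rewrite mem_filter mem_iota /= add0n.
by case: (boolP (i \in ps)) => //= /ltps /= ->.
Qed.

Lemma not_all_precede (w : seq nat) (x y : nat) :
  x <> y -> ~ all_precede w y x ->
  exists i j, [/\ i < j, j < size w, nth 0 w i = x & nth 0 w j = y].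
Proof.
move=> nxy nprec; apply: contrapT => none; apply: nprec => j i ltj lti wj wi.
rewrite ltnNge; apply/negP => leij; apply: none; exists i, j; split=> //.
rewrite ltn_neqAle leij andbT; apply/eqP => eij.
by apply: nxy; rewrite -wi -wj eij.
Qed.

(** If [b] and [c] were adjacent, the last [c] would precede the first [b], so
    that the increasing triple [a], [c], [d] would occur in this order. *)
Lemma nonadjacency_four_point (n : nat) (e : rel 'I_n) (w : seq nat) :
  represents12 e w -> avoids [:: 1; 2; 3] w ->
  forall a b c d : 'I_n, a < b -> b < c -> c < d ->
    ~~ e a c -> ~~ e b d -> ~~ e b c.
Proof.
move=> [_ rep] av a b c d ab bc cd nac nbd; apply/negP => /(rep _ _ bc) prec.
have inv (x y : 'I_n) : x < y -> ~~ e x y ->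
    exists i j, [/\ i < j, j < size w, nth 0 w i = x.+1 & nth 0 w j = y.+1].
  move=> xy nxy; apply: not_all_precede => [[exy]|/(rep _ _ xy)].
    by rewrite exy ltnn in xy.
  exact/negP.
have [i [j [ij ltj wi wj]]] := inv _ _ (ltn_trans ab bc) nac.
have [k [m [km ltm wk wm]]] := inv _ _ (ltn_trans bc cd) nbd.
have jm : j < m := ltn_trans (prec _ _ ltj (ltn_trans km ltm) wj wk) km.
apply: av; exists [:: a.+1; c.+1; d.+1].
  rewrite -wi -wj -wm; apply: (@subseq_of_positions w [:: i; j; m]).
    by rewrite /= ij jm.
  by rewrite /= ltm ltj (ltn_trans ij ltj).
by rewrite red_increasing //= !ltnS (ltn_trans ab bc) cd.
Qed.

(** The intervals are the smallest ones that contain the points of all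
    neighbours, so the edges are represented for free; the four-point property
    is what prevents two non-adjacent points from each lying in the interval of
    the other. *)
Lemma max_point_tolerance_of_four_point
    (R : realType) (V : finType) (e : rel V) (f : V -> nat) :
  injective f -> symmetric e ->
  (forall a b c d, f a < f b -> f b < f c -> f c < f d ->
    e a c -> e b d -> e b c) ->
  max_point_tolerance R e.
Proof.
move=> injf syme four.
pose N v u := (u == v) || e v u.
have Nvv v : N v v by rewrite /N eqxx.
pose lo v := [arg min_(u < v | N v u) f u].
pose hi v := [arg max_(u > v | N v u) f u].
have loP v : N v (lo v) /\ forall u, N v u -> f (lo v) <= f u.
  by rewrite /lo; case: arg_minnP.
have hiP v : N v (hi v) /\ forall u, N v u -> f u <= f (hi v).
  by rewrite /hi; case: arg_maxnP.
pose p v : R := ((f v)%:R)%R.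
pose I v := `[p (lo v), p (hi v)]%R.
have inI u v : (p u \in I v) = (f (lo v) <= f u <= f (hi v)).
  by rewrite in_itv /= /p !ler_nat.
have NI u v : N v u -> p u \in I v.
  by move=> Nu; rewrite inI (loP v).2 // (hiP v).2.
have edge u v : f u < f v -> p u \in I v -> p v \in I u -> e u v.
  move=> uv; rewrite !inI => /andP[lou _] /andP[_ hiv].
  have [Nlo _] := loP v; have [Nhi _] := hiP u.
  (* Neither extreme neighbour is the vertex itself, since [f u < f v]. *)
  have elo : e (lo v) v.
    case/orP: Nlo => [/eqP E|]; last by rewrite syme.
    by move: lou; rewrite E leqNgt uv.
  have ehi : e u (hi u).
    by case/orP: Nhi => [/eqP E|//]; move: hiv; rewrite E leqNgt uv.
  move: lou; rewrite leq_eqVlt => /predU1P[/injf <- //|lou].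
  move: hiv; rewrite leq_eqVlt => /predU1P[/injf -> //|hiv].
  exact: (four (lo v) u v (hi u)).
exists I, p; split=> [v|u v uv]; first exact: NI.
split=> [euv x /= [->|->]|sub].
- by split; apply: NI => //; rewrite /N syme euv orbT.
- by split; apply: NI => //; rewrite /N euv orbT.
have [_ /= puv] := sub (p u) (or_introl erefl).
have [/= pvu _] := sub (p v) (or_intror erefl).
case: (ltngtP (f u) (f v)) => [lt|lt|/injf E].
- exact: edge.
- by rewrite syme; apply: edge.
- by rewrite E eqxx in uv.
Qed.

Theorem corollary31 (R : realType) (V : finType) (G : rel V) :
  simple_graph G ->
  representable12_avoiding [:: 1; 2; 3] G ->
  exists H : rel V,
    [/\ simple_graph H, max_point_tolerance R H & G =2 complement H].
Proof.
move=> [symG irrG] [l [[l' lK l'K] [w [rep av]]]].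
have symH : symmetric (complement G) by move=> u v; rewrite /complement /= eq_sym symG.
exists (complement G); split.
- by split=> // v; rewrite /complement /= eqxx.
- apply: (@max_point_tolerance_of_four_point R V _ (fun v => l' v)) => //.
    by move=> u v /val_inj /(can_inj l'K).
  move=> a b c d ab bc cd /andP[_ nac] /andP[_ nbd].
  apply/andP; split; first by apply: contraTneq bc => ->; rewrite ltnn.
  have := nonadjacency_four_point rep av ab bc cd.
  by rewrite /= !l'K; apply.
- move=> u v; rewrite /complement /= negb_and !negbK.
  by case: eqVneq => [->|_] //=; rewrite irrG.
Qed.
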